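(* Let $H$ be a (possibly continuous-spectrum) self-adjoint linear operator on a separable complex Hilbert space $\mathcal{H}$, which is not the zero operator. Let $T:\mathcal{H}\to\mathcal{H}$ be an antiunitary bijection. If $T^2=-I$ and $[T,H]=0$ (that is, $T$ commutes with $H$), then $\{H\}^{\prime}\neq\{H\}^{\prime\prime}$, where $\{H\}^{\prime}$ is the commutant of $H$ (the set of bounded linear operators that commute with $H$) and $\{H\}^{\prime\prime}$ is the double-commutant of $H$ (the set of closed linear operators that commute with all the elements of $\{H\}^{\prime}$).
   Context: $I$ denotes the identity operator on $\mathcal{H}$. An antiunitary bijection $T:\mathcal{H}\to\mathcal{H}$ is an antilinear bijection with $\langle T\varphi,T\psi\rangle=\langle\varphi,\psi\rangle^*$ for all $\varphi,\psi\in\mathcal{H}$. The operator $H$ may be unbounded and is not assumed to have any eigenvector. For a self-adjoint operator $A$ on $\mathcal{H}$, the commutant $\{A\}^{\prime}$ is the set of bounded linear operators on $\mathcal{H}$ that commute with $A$. The double-commutant $\{A\}^{\prime\prime}$ is the set of closed linear operators on $\mathcal{H}$ (not required to be bounded) that commute with all the elements of $\{A\}^{\prime}$. A bounded everywhere-defined operator $B$ (linear or antilinear) commutes with a closed, possibly unbounded, linear operator $C$ with domain $D(C)$ if $B\,D(C)\subseteq D(C)$ and $BC\psi=CB\psi$ for all $\psi\in D(C)$; the condition $[T,H]=0$ and both definitions above are understood in this sense. *)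

(* Defs.v *)
From HB Require Import structures.
From mathcomp Require Import all_boot all_order all_algebra.
From mathcomp Require Import complex.
From mathcomp Require Import all_classical all_reals all_analysis.

Set Implicit Arguments.
Unset Strict Implicit.
Unset Printing Implicit Defensive.

Import Order.TTheory GRing.Theory Num.Theory.
Import numFieldNormedType.Exports.

Local Open Scope classical_set_scope.
Local Open Scope ring_scope.
Local Open Scope complex_scope.

(* A linear operator defined on a linear subspace [dom] of V. The value 0
   outside [dom] is a pure convention that makes Leibniz equality of [linop]s
   coincide with equality of partial functions (see [linop_eq]). *)
Record linop (K : pzRingType) (V : lmodType K) := Linop {
  dom : set V;
  app :> V -> V;
  dom0 : dom 0;
  domP : forall (a : K) (x y : V), dom x -> dom y -> dom (a *: x + y);
  appP : forall (a : K) (x y : V), dom x -> dom y ->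
    app (a *: x + y) = a *: app x + app y;
  app_out : forall x : V, ~ dom x -> app x = 0 }.

Lemma linop_eq (K : pzRingType) (V : lmodType K) (A B : linop V) :
  dom A = dom B -> (forall x, dom A x -> A x = B x) -> A = B.
Proof.
case: A => D f D0 DP fP fo; case: B => D' g D0' DP' gP go /= eD eq_fg.
subst D'; have efg : f = g.
  apply/funext => x; have [Dx|nDx] := pselect (D x); first exact: eq_fg.
  by rewrite fo // go.
by subst g; congr Linop; exact: Prop_irrelevance.
Qed.

Definition zero_op (K : pzRingType) (V : lmodType K) : linop V.
Proof.
refine (@Linop K V [set: V] (fun=> 0) _ _ _ _) => //.
by move=> a x y _ _; rewrite scaler0 addr0.
Defined.

Definition graph (K : pzRingType) (V : lmodType K) (A : linop V) : set (V * V) :=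
  [set p | dom A p.1 /\ p.2 = A p.1].

(* B is an everywhere-defined map, linear or antilinear in the uses below. *)
Definition commutes (K : pzRingType) (V : lmodType K) (B : V -> V)
    (C : linop V) : Prop :=
  (forall x, dom C x -> dom C (B x)) /\
  (forall x, dom C x -> B (C x) = C (B x)).

Section Hilbert.
Variable R : realType.
Variable V : completeNormedModType R[i].

(* V is a Hilbert space for [dot]: its (complete) norm is the one induced by
   [dot], which is linear in its first argument. *)
Definition hilbert_dot (dot : {dot V for Num.conj}) : Prop :=
  forall x : V, `|x| ^+ 2 = dot x x.

Definition separable : Prop := exists S : set V, countable S /\ dense S.

Definition densely_defined (A : linop V) : Prop := dense (dom A).

Definition closed_op (A : linop V) : Prop := closed (graph A).

Definition bounded_op (A : linop V) : Prop :=
  dom A = [set: V] /\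
  exists M : R, forall x : V, `|A x| <= M%:C * `|x|.

(* For densely defined A, this is the graph of the adjoint of A. *)
Definition adjoint_graph (dot : {dot V for Num.conj}) (A : linop V) :
    set (V * V) :=
  [set p | forall x, dom A x -> dot (A x) p.1 = dot x p.2].

Definition self_adjoint (dot : {dot V for Num.conj}) (A : linop V) : Prop :=
  densely_defined A /\ adjoint_graph dot A = graph A.

Definition antilinear (T : V -> V) : Prop :=
  forall (a : R[i]) (x y : V), T (a *: x + y) = Num.conj a *: T x + T y.

Definition antiunitary (dot : {dot V for Num.conj}) (T : V -> V) : Prop :=
  [/\ antilinear T, bijective T
    & forall x y : V, dot (T x) (T y) = Num.conj (dot x y)].

Definition commutant (A : linop V) : set (linop V) :=
  [set B | bounded_op B /\ commutes B A].

(* Dense domains are required, as usual for unbounded operators. Otherwise the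
   zero operator on the domain {0} would lie in every double-commutant, which
   would then differ from the commutant for trivial reasons. *)
Definition double_commutant (A : linop V) : set (linop V) :=
  [set C | [/\ densely_defined C, closed_op C
             & forall B, commutant A B -> commutes B C]].

End Hilbert.

(* Main.v *)
(* The closed operator H lies in {H}'', so {H}' = {H}'' would force H to be
   bounded and {H}' to be commutative. For w in the space let K(w) be the
   closure of {p(H) w | p polynomial}; the orthogonal projection on K(w) lies in
   {H}'. As T ^ 2 = -1, <w, f (T w)> = 0 for every self-adjoint f commuting with
   T, which makes K(w) and K(T w) orthogonal (Kramers degeneracy), and
   |p(H) w| = |p(H) (T w)|. Let P and Q be the projections on K(w) and
   K(w + T w). Then Q w = Q P (w + T w) = P Q (w + T w) = w, so that w is a
   limit of vectors p(H) w + p(H) (T w). By orthogonality p(H) w tends to w and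
   p(H) (T w) to 0, although they have the same norm; hence w = 0. *)
Require Import Defs.
From HB Require Import structures.
From mathcomp Require Import all_boot all_order all_algebra.
From mathcomp Require Import complex ring.
From mathcomp Require Import all_classical all_reals all_analysis.

Import Order.TTheory GRing.Theory Num.Theory.
Import numFieldNormedType.Exports.

Local Open Scope classical_set_scope.
Local Open Scope ring_scope.
Local Open Scope complex_scope.

Set Implicit Arguments.
Unset Strict Implicit.

(** * Inner product estimates *)

Section Projection.
Variables (R : realType) (V : completeNormedModType R[i]).
Variables (dot : {dot V for Num.conj}) (hdot : hilbert_dot dot).

Lemma dotC (u v : V) : dot u v = Num.conj (dot v u).
Proof. by rewrite hermC /= expr0 mul1r. Qed.

Lemma dotPl (a : R[i]) (u v w : V) :
  dot (a *: u + v) w = a * dot u w + dot v w.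
Proof. by rewrite linearDl linearZl_LR. Qed.

Lemma dotPr (a : R[i]) (u v w : V) :
  dot w (a *: u + v) = Num.conj a * dot w u + dot w v.
Proof. by rewrite linearDr linearZr_LR. Qed.

Lemma dot_eq0 (u : V) : dot u u = 0 -> u = 0.
Proof. by move=> /eqP; rewrite dnorm_eq0 => /eqP. Qed.

Lemma dot_pythagoras (u v : V) :
  dot u v = 0 -> `|u + v| ^+ 2 = `|u| ^+ 2 + `|v| ^+ 2.
Proof. by move=> uv; rewrite !hdot hnormDd. Qed.

(** Pythagoras for the component of [u] along [v]. Nonnegativity of the left side gives
    Cauchy-Schwarz, and its size controls near-minimizers of the distance to a subspace. *)
Lemma normB_proj (u v : V) : v != 0 ->
  `|u - (dot u v / `|v| ^+ 2) *: v| ^+ 2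
    = `|u| ^+ 2 - `|dot u v| ^+ 2 / `|v| ^+ 2.
Proof.
move=> v0; have n0 : `|v| ^+ 2 != 0 by rewrite expf_neq0// normr_eq0.
have nC : Num.conj (`|v| ^+ 2) = `|v| ^+ 2.
  by apply: geC0_conj; rewrite exprn_ge0.
rewrite (hdot (u - _)) dnormB dnormZ -!hdot (linearZr_LR dot) /=.
rewrite !normCK !rmorphM /= !fmorphV /= !nC conjCK.
by field; rewrite normr_eq0.
Qed.

Lemma dot_cauchy_schwarz (u v : V) : `|dot u v| <= `|u| * `|v|.
Proof.
have [->|v0] := eqVneq v 0; first by rewrite linear0r !normr0 mulr0.
have n0 : 0 < `|v| ^+ 2 by rewrite exprn_gt0// normr_gt0.
rewrite -ler_sqr ?nnegrE ?mulr_ge0// exprMn -ler_pdivrMr// -subr_ge0.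
by rewrite -normB_proj// exprn_ge0.
Qed.

Lemma norm_le_small_eq0 (z M : R[i]) : 0 <= M ->
  (forall e : R[i], 0 < e -> `|z| <= e * M) -> z = 0.
Proof.
move=> M0 small; apply/eqP; rewrite -normr_le0; apply/negPn/negP => z0.
have {}z0 : 0 < `|z|.
  by rewrite normr_gt0; apply: contra z0 => /eqP->; rewrite normr0.
have M1 : 0 < M + 1 by rewrite ltr_wpDl.
have := small _ (divr_gt0 z0 M1).
rewrite -mulrA -{1}(mulr1 `|z|) ler_pM2l// mulrC ler_pdivlMr// mul1r.
by rewrite gerDl ler10.
Qed.

Lemma closure_normP (S : set V) (p : V) :
  closure S p <-> forall e : R[i], 0 < e -> exists2 s, S s & `|p - s| < e.
Proof.
split=> [Sp e e0|Sp B /nbhs_ballP[e /= e0 Be]].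
  have [s [Ss]] := Sp _ (nbhsx_ballx p e e0).
  by rewrite -ball_normE /= => ps; exists s.
have [s Ss ps] := Sp e e0; exists s; split => //.
by apply: Be; rewrite -ball_normE.
Qed.

Lemma parallelogram (u v : V) :
  `|u + v| ^+ 2 + `|u - v| ^+ 2 = 2 * (`|u| ^+ 2 + `|v| ^+ 2).
Proof. by rewrite !hdot dnormD dnormB; ring. Qed.

(** * Orthogonal projection onto the closure of a subspace *)

Section Subspace.
Variables (S : set V) (S0 : S 0).
Hypothesis SP : forall (a : R[i]) x y, S x -> S y -> S (a *: x + y).

Lemma subspaceZ a x : S x -> S (a *: x).
Proof. by move=> Sx; rewrite -[_ *: _]addr0; exact: SP. Qed.

Lemma sqr_dist_inf (x : V) : exists D : R[i],
  (forall s, S s -> D <= `|x - s| ^+ 2) /\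
  (forall e, 0 < e -> exists2 s, S s & `|x - s| ^+ 2 < D + e).
Proof.
(* Norms take values in [R[i]], which is only partially ordered, so the infimum is formed in [R]
   from real parts. *)
pose q s := complex.Re (`|x - s| ^+ 2).
have qE s : (q s)%:C = `|x - s| ^+ 2.
  by rewrite RRe_real// ger0_real// exprn_ge0.
pose E := [set q s | s in S].
have E_inf : has_inf E.
  split; first by exists (q 0); exists 0.
  by exists 0 => _ [s _ <-]; rewrite -lecR qE exprn_ge0.
exists (inf E)%:C; split=> [s Ss|e e0].
  by rewrite -qE lecR; apply: ge_inf; [exact: E_inf.2|exists s].
have eE : (complex.Re e)%:C = e by rewrite RRe_real// gtr0_real.
have [|_ [s Ss <-] qs] := @inf_adherent _ E (complex.Re e) _ E_inf.
  by rewrite -ltcR eE.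
by exists s => //; rewrite -qE -eE -rmorphD ltcR.
Qed.

(** Moving [s] by the component of [x - s] along [t] stays in [S] and lowers the squared distance by
    [|dot (x - s) t|^2 / |t|^2]; minimality of [D] leaves room for at most [e ^+ 2]. *)
Lemma near_minimizer_dot (x s t : V) (D e : R[i]) :
  (forall y, S y -> D <= `|x - y| ^+ 2) -> 0 <= e ->
  S s -> S t -> `|x - s| ^+ 2 < D + e ^+ 2 -> `|dot (x - s) t| <= e * `|t|.
Proof.
move=> Dmin e0 Ss St xs.
have [->|t0] := eqVneq t 0; first by rewrite linear0r !normr0 mulr0.
have n0 : 0 < `|t| ^+ 2 by rewrite exprn_gt0// normr_gt0.
rewrite -ler_sqr ?nnegrE ?mulr_ge0// exprMn -ler_pdivrMr//.
have := Dmin _ (SP (dot (x - s) t / `|t| ^+ 2) St Ss).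
rewrite opprD addrCA [X in `|X|]addrC normB_proj// lerBrDr => Ds.
by rewrite -(lerD2l D) (le_trans Ds) ?ltW.
Qed.

(** The midpoint of [s] and [t] lies in [S], so its squared distance to [x] is at least [D]; the
    parallelogram law then bounds [s - t]. *)
Lemma near_minimizers_close (x s t : V) (D a b : R[i]) :
  (forall y, S y -> D <= `|x - y| ^+ 2) ->
  S s -> S t -> `|x - s| ^+ 2 < D + a -> `|x - t| ^+ 2 < D + b ->
  `|s - t| ^+ 2 <= 2 * (a + b).
Proof.
move=> Dmin Ss St xs xt.
have m : `|(x - t) + (x - s)| ^+ 2 = 4 * `|x - (2^-1 *: s + 2^-1 *: t)| ^+ 2.
  have -> : (x - t) + (x - s) = (2 : R[i]) *: (x - (2^-1 *: s + 2^-1 *: t)).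
    rewrite scalerBr scalerDr !scalerA mulfV ?pnatr_eq0// !scale1r.
    by rewrite scaler_nat mulr2n opprD addrACA (addrC (- t)).
  by rewrite normrZ exprMn ger0_norm ?ler0n// -natrX.
have := parallelogram (x - t) (x - s); rewrite m.
have -> : x - t - (x - s) = s - t by rewrite opprB addrC addrA subrK.
move=> /(canRL (addKr _)) ->.
have Dm := Dmin _ (SP 2^-1 Ss (subspaceZ 2^-1 St)).
rewrite addrC lerBlDr (@le_trans _ _ (2 * ((D + b) + (D + a))))//.
  by rewrite ler_pM2l ?ltr0n// lerD ?ltW.
have -> : 2 * (D + b + (D + a)) = 2 * (a + b) + 4 * D by ring.
by rewrite lerD2l ler_pM2l ?ltr0n.
Qed.

Lemma invSn_complex_lt (e : R[i]) : 0 < e ->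
  \forall n \near \oo, ((n.+1%:R : R)^-1)%:C < e.
Proof.
move=> e0; have eE : (complex.Re e)%:C = e by rewrite RRe_real// gtr0_real.
have r0 : 0 < complex.Re e by rewrite -ltcR eE.
near=> n; rewrite -eE ltcR; near: n.
exact: (near_infty_natSinv_lt (PosNum r0)).
Unshelve. all: by end_near. Qed.

(** [S] need not be closed: [p] is sought in its closure, while orthogonality is tested on [S] alone
    and extends to the closure by continuity. *)
Definition orthogonal_projection (x p : V) : Prop :=
  closure S p /\ forall s, S s -> dot (x - p) s = 0.

Lemma orthogonal_projection_exists (x : V) :
  exists p, orthogonal_projection x p.
Proof.
have [D [Dmin Dinf]] := sqr_dist_inf x.
have eps0 n : 0 < ((n.+1%:R : R)^-1)%:C :> R[i] by rewrite ltcR.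
pose good n s := S s /\ `|x - s| ^+ 2 < D + ((n.+1%:R : R)^-1)%:C.
have [s sP] : {s : V^nat & forall n, good n (s n)}.
  apply: (@choice _ _ good) => n.
  by have [s Ss xs] := Dinf _ (eps0 n); exists s.
have s_cvg : cvg (s @ \oo).
  apply/cauchy_cvgP/cauchy_exP => e e0.
  (* With both tolerances below [e ^+ 2 / 4], the bound [2 * (a + b)] falls below [e ^+ 2], so a
     minimizing sequence is Cauchy. *)
  have e4 : 0 < e ^+ 2 / 4 by rewrite divr_gt0 ?exprn_gt0 ?ltr0n.
  near \oo => N; exists (s N).
  suff : \forall n \near \oo, ball (s N) e (s n) by [].
  near=> n.
  rewrite -ball_normE /= -ltr_sqr ?nnegrE ?normr_ge0 ?(ltW e0)//.
  have [[SN xN] [Sn xn]] := (sP N, sP n).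
  apply: le_lt_trans (near_minimizers_close Dmin SN Sn xN xn) _.
  have -> : e ^+ 2 = 2 * (e ^+ 2 / 4 + e ^+ 2 / 4) by field.
  rewrite ltr_pM2l ?ltr0n// ltrD//.
    by near: N; exact: invSn_complex_lt.
  by near: n; exact: invSn_complex_lt.
have approx : forall d : R[i], 0 < d -> exists t,
    [/\ S t, `|lim (s @ \oo) - t| < d & `|x - t| ^+ 2 < D + d ^+ 2].
  move=> d d0; near \oo => k; exists (s k); have [Sk xk] := sP k; split => //.
    near: k; have /cvgrPdist_lt/(_ d d0) := s_cvg; exact.
  apply: lt_trans xk _; rewrite ltrD2l.
  by near: k; apply: invSn_complex_lt; rewrite exprn_gt0.
exists (lim (s @ \oo)); split.
  by apply/closure_normP => e /approx[t [St pt _]]; exists t.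
move=> t St; apply: (@norm_le_small_eq0 _ (2 * `|t|)) => [|e e0].
  by rewrite mulr_ge0 ?ler0n.
have [r [Sr pr xr]] := approx e e0.
(* The first term is nearly orthogonal to [t] by near-minimality of [r], the second is small; each
   contributes [e * |t|]. *)
have -> : x - lim (s @ \oo) = (x - r) - (lim (s @ \oo) - r).
  by rewrite opprB addrC addrA subrK addrC.
rewrite linearBl (le_trans (ler_normB _ _))//.
have -> : e * (2 * `|t|) = e * `|t| + e * `|t| by ring.
rewrite lerD//; first exact: (near_minimizer_dot Dmin (ltW e0) Sr St xr).
by rewrite (le_trans (dot_cauchy_schwarz _ _))// ler_wpM2r// ltW.
Unshelve. all: by end_near. Qed.

Lemma closure_subspace (a : R[i]) (x y : V) :
  closure S x -> closure S y -> closure S (a *: x + y).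
Proof.
move=> /closure_normP Sx /closure_normP Sy; apply/closure_normP => e e0.
have a1 : 0 < `|a| + 1 by rewrite ltr_wpDl.
have e2 : 0 < e / 2 by rewrite divr_gt0 ?ltr0n.
have [s Ss xs] := Sx _ (divr_gt0 e2 a1).
have [t St yt] := Sy _ e2.
exists (a *: s + t); first exact: SP.
rewrite opprD addrACA -scalerBr (le_lt_trans (ler_normD _ _))// normrZ.
have -> : e = e / 2 + e / 2 by field.
rewrite ler_ltD//; apply: (@le_trans _ _ ((`|a| + 1) * `|x - s|)).
  by rewrite ler_wpM2r// lerDl ler01.
by rewrite mulrC -ler_pdivlMr// ltW.
Qed.

Lemma dot_closure_eq0 (u p : V) :
  (forall s, S s -> dot u s = 0) -> closure S p -> dot u p = 0.
Proof.
move=> uS /closure_normP Sp; apply: (@norm_le_small_eq0 _ `|u|) => // e e0.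
have [s Ss ps] := Sp _ e0.
rewrite -[dot u p]subr0 -(uS _ Ss) -linearBr.
by rewrite (le_trans (dot_cauchy_schwarz _ _))// mulrC ler_wpM2r// ltW.
Qed.

Lemma orthogonal_projection_unique (x p q : V) :
  orthogonal_projection x p -> orthogonal_projection x q -> p = q.
Proof.
(* [p - q] lies in the closure of [S] and is orthogonal to [S], hence orthogonal to itself. *)
move=> [Sp xp] [Sq xq]; apply/eqP; rewrite -subr_eq0; apply/eqP/dot_eq0.
apply: dot_closure_eq0; last first.
  by rewrite addrC -scaleN1r; exact: closure_subspace.
move=> s Ss; have -> : p - q = (x - q) - (x - p).
  by rewrite opprB [RHS]addrC addrA subrK.
by rewrite linearBl /= xq// xp// subrr.
Qed.

Lemma orthogonal_projection_linear (a : R[i]) (x y p q : V) :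
  orthogonal_projection x p -> orthogonal_projection y q ->
  orthogonal_projection (a *: x + y) (a *: p + q).
Proof.
move=> [Sp xp] [Sq yq]; split; first exact: closure_subspace.
move=> s Ss; rewrite opprD addrACA -scalerBr dotPl xp// yq//.
by rewrite mulr0 addr0.
Qed.

Lemma orthogonal_projection_norm (x p : V) :
  orthogonal_projection x p -> `|p| <= `|x|.
Proof.
move=> [Sp xp]; rewrite -ler_sqr ?nnegrE//.
have -> : x = (x - p) + p by rewrite subrK.
by rewrite (dot_pythagoras (dot_closure_eq0 xp Sp)) lerDr exprn_ge0.
Qed.
End Subspace.

(** * Projections onto invariant subspaces commute with a bounded symmetric operator *)

Lemma linopB (H : linop V) (x y : V) : dom H = setT -> H (x - y) = H x - H y.
Proof.
move=> HT; have D z : dom H z by rewrite HT.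
by rewrite [x - y]addrC [RHS]addrC -(scaleN1r y) Defs.appP// scaleN1r.
Qed.

Lemma closure_bounded_op (H : linop V) (S : set V) (x : V) :
  bounded_op H -> (forall s, S s -> S (H s)) -> closure S x -> closure S (H x).
Proof.
move=> [HT [M HM]] SH /closure_normP Sx; apply/closure_normP => e e0.
have M1 : 0 < `|M%:C| + 1 :> R[i] by rewrite ltr_wpDl.
have [s Ss xs] := Sx _ (divr_gt0 e0 M1).
exists (H s); first exact: SH.
rewrite -linopB// (le_lt_trans (HM _))//.
apply: (@le_lt_trans _ _ ((`|M%:C| + 1) * `|x - s|)).
  rewrite ler_wpM2r// (le_trans (real_ler_norm _))//.
    by rewrite complex_real.
  by rewrite lerDl ler01.
by rewrite mulrC -ltr_pdivlMr.
Qed.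

Lemma commutant_projection (H : linop V) (S : set V) :
  bounded_op H -> (forall x y, dot (H x) y = dot x (H y)) ->
  S 0 -> (forall (a : R[i]) x y, S x -> S y -> S (a *: x + y)) ->
  (forall s, S s -> S (H s)) ->
  exists2 P : linop V, commutant H P
    & forall x, orthogonal_projection S x (P x).
Proof.
move=> Hbd Hsym S0 SP SH.
have [P PP] := choice (orthogonal_projection_exists S0 SP).
have PD (a : R[i]) (x y : V) : P (a *: x + y) = a *: P x + P y.
  apply: (orthogonal_projection_unique SP (PP _)).
  exact: orthogonal_projection_linear.
exists (@Linop _ V setT P I (fun _ _ _ _ _ => I) (fun a x y _ _ => PD a x y)
  (fun x nx => False_ind _ (nx I))) => //; split.
  split=> //; exists 1 => x; rewrite mul1r /=.
  exact: orthogonal_projection_norm (PP x).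
split=> [x _|x _ /=]; first by rewrite Hbd.1.
(* [H (P x)] is the projection of [H x]: it stays in the closure of [S], and symmetry moves [H] from
   [x - P x] onto [s], where invariance of [S] applies. *)
apply: (orthogonal_projection_unique SP (PP _)); split.
  by apply: closure_bounded_op => //; case: (PP x).
by move=> s Ss; rewrite -linopB ?Hbd.1// Hsym; apply: (PP x).2; exact: SH.
Qed.

End Projection.

(* The vectors p(f) w, for p a polynomial and f linear. Over V * V these are the
   pairs (p(f) u, p(f) v) with the same p. *)
Inductive krylov (K : pzRingType) (W : lmodType K) (f : W -> W) (w : W) :
    W -> Prop :=
| krylov_gen : krylov f w w
| krylov_app x : krylov f w x -> krylov f w (f x)
| krylov_lin (a : K) x y :
    krylov f w x -> krylov f w y -> krylov f w (a *: x + y).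

Lemma krylov0 (K : pzRingType) (W : lmodType K) (f : W -> W) (w : W) :
  krylov f w 0.
Proof.
by rewrite -(addNr w) -scaleN1r; apply: krylov_lin; exact: krylov_gen.
Qed.

(** * Kramers degeneracy for Krylov subspaces *)

Section Kramers.
Variables (R : realType) (V : completeNormedModType R[i]).
Variables (dot : {dot V for Num.conj}) (hdot : hilbert_dot dot).
Variables (T : V -> V) (hT : antiunitary dot T).
Hypothesis TT : forall x, T (T x) = - x.

(** Inserting [T (T w) = - w] and then applying antiunitarity and symmetry shows that the number
    equals its own negative. *)
Lemma kramers (f : V -> V) (w : V) :
  (forall x y, dot (f x) y = dot x (f y)) -> (forall x, T (f x) = f (T x)) ->
  dot w (f (T w)) = 0.
Proof.
move=> fsym Tf; have [_ _ Tdot] := hT.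
have /eqP : dot w (f (T w)) = - dot w (f (T w)).
  transitivity (- dot (T (T w)) (f (T w))); first by rewrite TT linearNl opprK.
  by rewrite -Tf Tdot -(dotC dot) Tf fsym.
by rewrite -addr_eq0 -mulr2n mulrn_eq0 => /eqP.
Qed.

Lemma antiunitary_dot_self (f : V -> V) (w : V) :
  (forall x y, dot (f x) y = dot x (f y)) -> (forall x, T (f x) = f (T x)) ->
  dot w (f w) = dot (T w) (f (T w)).
Proof.
move=> fsym Tf; have [_ _ Tdot] := hT.
by rewrite -Tf Tdot -(dotC dot) fsym.
Qed.

Variable f : V -> V.
Hypotheses (fsym : forall x y, dot (f x) y = dot x (f y))
  (Tf : forall x, T (f x) = f (T x)).

Lemma iter_sym n x y : dot (iter n f x) y = dot x (iter n f y).
Proof. by elim: n y => //= n IH y; rewrite fsym IH -iterSr. Qed.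

Lemma iter_antiunitary n x : T (iter n f x) = iter n f (T x).
Proof. by elim: n => //= n IH; rewrite Tf IH. Qed.

Lemma krylov_orthogonal (w x y : V) :
  krylov f w x -> krylov f (T w) y -> dot x y = 0.
Proof.
move=> wx wy; elim: wy x wx => [|z _ xz|a z z' _ xz _ xz'] x wx.
(* All powers are needed for the induction: an [f] applied on the left becomes one more power on the
   right, down to [kramers] for [iter n f]. *)
- suff: forall n, dot x (iter n f (T w)) = 0 by move/(_ 0).
  elim: wx => [n|z _ IH n|a z z' _ IH _ IH' n].
  + exact: kramers (iter_sym n) (iter_antiunitary n).
  + by rewrite fsym -iterS.
  + by rewrite dotPl IH IH' mulr0 addr0.
- by rewrite -fsym xz//; exact: krylov_app.
- by rewrite dotPr xz// xz'// mulr0 addr0.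
Qed.

Definition pair_app (p : V * V) := (f p.1, f p.2).

Lemma krylov_pair1 (u v : V) (p : V * V) :
  krylov pair_app (u, v) p -> krylov f u p.1.
Proof.
elim=> [|q _ IH|a q r _ IH _ IH']; first exact: krylov_gen.
- exact: krylov_app.
- exact: krylov_lin.
Qed.

Lemma krylov_pair2 (u v : V) (p : V * V) :
  krylov pair_app (u, v) p -> krylov f v p.2.
Proof.
elim=> [|q _ IH|a q r _ IH _ IH']; first exact: krylov_gen.
- exact: krylov_app.
- exact: krylov_lin.
Qed.

(** [T] is antilinear and would conjugate the coefficients of a polynomial, so it does not carry
    [p.1] to [p.2]. The moments of [w] and [T w] under [f] nevertheless agree, being real by
    symmetry, and they determine these inner products. *)
Lemma krylov_isometry (w : V) (p q : V * V) :
  krylov pair_app (w, T w) p -> krylov pair_app (w, T w) q ->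
  dot p.1 q.1 = dot p.2 q.2.
Proof.
move=> wp wq; elim: wq p wp => [|r _ pr|a r r' _ pr _ pr'] p wp.
- suff: forall n, dot p.1 (iter n f w) = dot p.2 (iter n f (T w)) by move/(_ 0).
  elim: wp => [n|r _ IH n|a r r' _ IH _ IH' n] /=.
  + exact: antiunitary_dot_self (iter_sym n) (iter_antiunitary n).
  + by rewrite !fsym -!iterS.
  + by rewrite !dotPl IH IH'.
- by rewrite /= -!fsym; exact: (pr (pair_app p) (krylov_app wp)).
- by rewrite /= !dotPr pr// pr'.
Qed.

Lemma krylov_sum (u v x : V) :
  (forall (a : R[i]) y z, f (a *: y + z) = a *: f y + f z) ->
  krylov f (u + v) x ->
  exists2 p, krylov pair_app (u, v) p & x = p.1 + p.2.
Proof.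
move=> fP; elim=> [|y _ [p wp ->]|a y z _ [p wp ->] _ [q wq ->]].
- by exists (u, v) => //; exact: krylov_gen.
- exists (pair_app p); first exact: krylov_app.
  by rewrite /= -[p.1]scale1r fP !scale1r.
- exists (a *: p + q); first exact: krylov_lin.
  by rewrite /= scalerDr addrACA.
Qed.

Lemma closure_krylov_sum_eq0 (w : V) :
  (forall (a : R[i]) y z, f (a *: y + z) = a *: f y + f z) ->
  closure (krylov f (w + T w) : set V) w -> w = 0.
Proof.
move=> fP /closure_normP Sw; apply/eqP; rewrite -normr_eq0; apply/eqP.
(* The factor 2 comes from [|w| <= |w - p.1| + |p.1|], where each term is at most [e], the last
   because [|p.1| = |p.2|]. *)
apply: (@norm_le_small_eq0 _ _ 2) => [|e e0]; first exact: ler0n.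
have [_ /(krylov_sum fP)[p wp ->] wpe] := Sw e e0.
have w1 := krylov_pair1 wp; have w2 := krylov_pair2 wp.
have orth : dot (w - p.1) (- p.2) = 0.
  rewrite linearNr linearBl /= (krylov_orthogonal (krylov_gen f w) w2).
  by rewrite (krylov_orthogonal w1 w2) subrr oppr0.
have := dot_pythagoras hdot orth.
rewrite normrN -addrA -opprD => pyth.
have le_e u : `|u| ^+ 2 <= `|w - (p.1 + p.2)| ^+ 2 -> `|u| <= e.
  by rewrite ler_sqr ?nnegrE// => /le_trans -> //; exact: ltW.
have le1 : `|w - p.1| <= e by apply: le_e; rewrite pyth lerDl exprn_ge0.
have le2 : `|p.2| <= e by apply: le_e; rewrite pyth lerDr exprn_ge0.
have e12 : `|p.1| = `|p.2|.
  apply/eqP; rewrite -(@eqrXn2 _ 2)// !hdot; apply/eqP.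
  exact: (krylov_isometry wp wp).
rewrite normr_id -(subrK p.1 w) (le_trans (ler_normD _ _))//.
by rewrite mulr_natr mulr2n lerD// e12.
Qed.
End Kramers.

(** * Closedness of self-adjoint operators, and the contradiction *)

Lemma self_adjoint_closed (R : realType) (V : completeNormedModType R[i])
    (dot : {dot V for Num.conj}) (H : linop V) :
  hilbert_dot dot -> self_adjoint dot H -> closed_op H.
Proof.
(* The adjoint graph is cut out by the equations [dot (H x) p = dot x q], which survive limits by
   Cauchy-Schwarz. *)
move=> hdot [_ HE]; rewrite /closed_op -HE => -[p q] cl x Hx /=.
apply/eqP; rewrite -subr_eq0; apply/eqP.
apply: (@norm_le_small_eq0 _ _ (`|H x| + `|x|)); first by rewrite addr_ge0.
move=> e e0.
have [[p' q'] [/(_ x Hx)/= E [/= pp' qq']]] := cl _ (nbhsx_ballx (p, q) e e0).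
move: pp' qq'; rewrite -!ball_normE /= => pp' qq'.
have -> : dot (H x) p - dot x q = dot (H x) (p - p') - dot x (q - q').
  by rewrite !linearBr /= E opprB addrA subrK.
rewrite (le_trans (ler_normB _ _))// mulrDr lerD//.
  by rewrite (le_trans (dot_cauchy_schwarz hdot _ _))// mulrC ler_wpM2r// ltW.
by rewrite (le_trans (dot_cauchy_schwarz hdot _ _))// mulrC ler_wpM2r// ltW.
Qed.

Lemma linop_total_eq0 (K : pzRingType) (V : lmodType K) (H : linop V) :
  dom H = setT -> (forall x, H x = 0) -> H = zero_op V.
Proof. by move=> HT H0; apply: linop_eq. Qed.

Unset Implicit Arguments.

Theorem proposition3 (R : realType) (V : completeNormedModType R[i])
    (dot : {dot V for Num.conj}) (hdot : hilbert_dot dot)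
    (hsep : separable V)
    (H : linop V) (hH : self_adjoint dot H) (hH0 : H <> zero_op V)
    (T : V -> V) (hT : antiunitary dot T)
    (hT2 : forall x : V, T (T x) = - x)
    (hTH : commutes T H) :
  commutant H <> double_commutant H.
Proof.
move=> eqC.
have [Hbd _] : commutant H H.
  rewrite eqC; split; [exact: hH.1|exact: self_adjoint_closed hdot hH|].
  by move=> B [].
have HT := Hbd.1; have D x : dom H x by rewrite HT.
have Hsym x y : dot (H x) y = dot x (H y).
  have : graph H (y, H y) by split.
  by rewrite -hH.2 => /(_ x (D x)).
have HP (a : R[i]) x y : H (a *: x + y) = a *: H x + H y by exact: Defs.appP.
have TH x : T (H x) = H (T x) by exact: hTH.2.
have proj w := commutant_projection hdot Hbd Hsym (krylov0 H w)
  (@krylov_lin _ _ H w) (@krylov_app _ _ H w).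
(* The contradiction comes from showing that every vector [w] vanishes, which makes [H] the zero
   operator. *)
apply: hH0; apply: linop_total_eq0 => // w.
suff -> : w = 0 by have := HP (-1) 0 0; rewrite scaleN1r addNr scaleN1r addNr.
have [P PC PP] := proj w; have [Q QC QP] := proj (w + T w).
apply: (closure_krylov_sum_eq0 hdot hT hT2 Hsym TH HP).
(* The remainder [T w] is orthogonal to the Krylov space of [w]. *)
have Pw : P (w + T w) = w.
  apply: (orthogonal_projection_unique hdot (@krylov_lin _ _ H w) (PP _)).
  split; first by apply: subset_closure; exact: krylov_gen.
  move=> s ws; rewrite addrC addKr (dotC dot).
  rewrite (krylov_orthogonal hT hT2 Hsym TH ws); last exact: krylov_gen.
  exact: conjC0.
have Qw : Q (w + T w) = w + T w.
  apply: (orthogonal_projection_unique hdot (@krylov_lin _ _ H _) (QP _)).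
  split; first by apply: subset_closure; exact: krylov_gen.
  by move=> s ws; rewrite subrr linear0l.
(* The assumed equality turns [Q] from a member of the commutant into one of the double-commutant,
   so it commutes with [P]. *)
have [_ _ /(_ _ PC)[_ PQ]] : double_commutant H Q by rewrite -eqC.
have Qw' : Q w = w by rewrite -{1}Pw -PQ ?Qw// QC.1.1.
by have := (QP w).1; rewrite Qw'.
Qed.
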